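(* Let $r\in(0,1)$. Let $\{A_k\}_{k\ge 0}$ be i.i.d. complex valued random variables with $\mathbb{P}(A_0=0)<1$ and $\mathbb{E}(|A_0|^2)<\infty$, and let $P_n(z)=\sum_{k=0}^n A_k z^k$. Then there exists a positive random variable $X_{2,r}$ such that $$0<\lim_{n\to\infty}\frac{\|P_n'\|_{2,r}}{\|P_n\|_{2,r}}=X_{2,r}<\infty\quad\text{almost surely.}$$ Furthermore, $$\lim_{n\to\infty}\mathbb{E}\left[\frac{\|P_n'\|_{2,r}}{\|P_n\|_{2,r}}\right]=\mathbb{E}[X_{2,r}]<\infty.$$
   Context: For a polynomial $P$ and $r>0$, $\|P\|_{2,r}=\left(\frac{1}{2\pi}\int_0^{2\pi}|P(re^{it})|^2\,dt\right)^{1/2}$, and $P'$ is the derivative of $P$ in $z$. Convention: the ratio $\|P'\|_{2,r}/\|P\|_{2,r}$ is set equal to $0$ when $P\equiv 0$. *)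

(* Defs.v *)
From HB Require Import structures.
From mathcomp Require Import all_boot all_order all_algebra.
From mathcomp Require Import all_classical all_reals all_analysis.
From mathcomp Require Import finmap complex.

Set Implicit Arguments.
Unset Strict Implicit.
Unset Printing Implicit Defensive.

Import Order.TTheory GRing.Theory Num.Theory.
Import numFieldNormedType.Exports.
Import ComplexField.

Local Open Scope classical_set_scope.
Local Open Scope ring_scope.
Local Open Scope complex_scope.

(* The complex numbers with their Borel sigma-algebra; the alias ^o is what
   gives R[i] the topology of its norm. *)
Notation borelC R := (g_sigma_algebraType (@open R[i]^o)).

Section iid.
Context d d' (T : measurableType d) (T' : measurableType d') (R : realType).
Variable P : probability T R.

Definition mutually_independent (I : choiceType) (X : I -> T -> T') : Prop :=
  forall (J : {fset I}) (B : I -> set T'), (forall i, measurable (B i)) ->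
    P (\bigcap_(i in [set` J]) (X i @^-1` B i)) =
    (\prod_(i <- J) P (X i @^-1` B i))%E.

Definition identically_distributed (I : Type) (X : I -> {RV P >-> T'}) : Prop :=
  forall (i j : I) (B : set T'), measurable B ->
    distribution P (X i) B = distribution P (X j) B.

End iid.

Section norms.
Variable R : realType.
Implicit Types (r t : R) (p : {poly R[i]}).

Definition circle_pt r t : R[i] := (r * cos t) +i* (r * sin t).

(* normc is the modulus as an element of R (`|z| is R[i]-valued). *)
Definition norm2 r p : R :=
  Num.sqrt ((2 * pi)^-1 *
    \int[lebesgue_measure]_(t in `[0, 2 * pi]) (Normc.normc p.[circle_pt r t] ^+ 2)).

Definition deriv_ratio r p : R :=
  if p == 0 then 0 else norm2 r p^`() / norm2 r p.

Definition partial_poly (a : nat -> R[i]) (n : nat) : {poly R[i]} :=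
  \poly_(k < n.+1) a k.

End norms.

(* Main.v *)
(* Put [b_k := |A_k|^2].  By Parseval the squared ratio is
   [(sum_(k <= n) k^2 b_k r^(2k)) / (r^2 sum_(k <= n) b_k r^(2k))].
   Fix [delta > 0] with [P (b_0 < delta) < 1] and let [tau >= 1] be such that
   [b_tau >= delta] while [b_i < delta] for [1 <= i < tau].  Splitting the
   numerator at [tau], the part up to [tau] is at most [tau^2] times the
   denominator, and the denominator is at least [delta r^(2 tau)] once
   [n >= tau]; this bounds the squared ratio, uniformly in [n], by
   [r^-2 (tau^2 + delta^-1 sum_j (tau + j)^2 b_(tau + j) r^(2j))].
   Summing over the possible values of [tau], and using that [tau] has a
   geometric tail and that [b_(t + j)] is independent of [b_1, ..., b_(t-1)],
   this bound is integrable.  Where it is finite, numerator and denominator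
   converge to positive limits; dominated convergence does the rest. *)

Require Import Defs.
From HB Require Import structures.
From mathcomp Require Import all_boot all_order all_algebra.
From mathcomp Require Import all_classical all_reals all_analysis.
From mathcomp Require Import finmap complex measurable_realfun ring lra.

Set Implicit Arguments.
Unset Strict Implicit.
Unset Printing Implicit Defensive.

Import Order.TTheory GRing.Theory Num.Theory.
Import numFieldNormedType.Exports.
Import ComplexField.

Local Open Scope classical_set_scope.
Local Open Scope ring_scope.
Local Open Scope complex_scope.

(** * Parseval's identity on a circle *)

Section parseval.
Variable R : realType.
Implicit Types (r t : R) (p : {poly R[i]}).

Lemma normc_sqr (z : R[i]) : Normc.normc z ^+ 2 = complex.Re z ^+ 2 + complex.Im z ^+ 2.
Proof. by case: z => x y /=; rewrite sqr_sqrtr // addr_ge0 ?sqr_ge0. Qed.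

Lemma circle_ptX r t k :
  circle_pt r t ^+ k = (r ^+ k * cos (k%:R * t)) +i* (r ^+ k * sin (k%:R * t)).
Proof.
elim: k => [|k IH].
  by rewrite !expr0 mul0r cos0 sin0 mulr1 mulr0.
rewrite exprS IH /circle_pt -[k.+1]addn1 natrD mulrDl mul1r cosD sinD exprD expr1.
by apply/eqP; rewrite eq_complex /=; apply/andP; split; apply/eqP; ring.
Qed.

(** Each summand is the real part of the [j]-th term of [p] times the conjugate of the [k]-th,
    written with real sines and cosines so that it has an elementary antiderivative. *)
Lemma normc_horner_circle r t p :
  Normc.normc p.[circle_pt r t] ^+ 2 =
  \sum_(j < size p) \sum_(k < size p) r ^+ (j + k) *
    ((complex.Re p`_j * complex.Re p`_k + complex.Im p`_j * complex.Im p`_k) *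
       cos ((j%:R - k%:R) * t) +
     (complex.Re p`_j * complex.Im p`_k - complex.Im p`_j * complex.Re p`_k) *
       sin ((j%:R - k%:R) * t)).
Proof.
rewrite normc_sqr horner_coef !raddf_sum /= !expr2 !big_distrl /= -big_split /=.
apply: eq_bigr => j _; rewrite !big_distrr /= -big_split /=.
apply: eq_bigr => k _; rewrite !circle_ptX.
case: p`_j => a b; case: p`_k => c e /=.
by rewrite [(_ - _) * t]mulrBl cosB sinB exprD; ring.
Qed.

(** The diagonal is set apart: there the integrand is constant in [t], and dividing by [j%:R - k%:R]
    would silently give 0. *)
Definition fourier_antiderivative r p t : R :=
  \sum_(j < size p) \sum_(k < size p) r ^+ (j + k) *
    (if j == k then Normc.normc p`_j ^+ 2 * t else
    ((complex.Re p`_j * complex.Re p`_k + complex.Im p`_j * complex.Im p`_k) / (j%:R - k%:R)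
       * sin ((j%:R - k%:R) * t) -
     (complex.Re p`_j * complex.Im p`_k - complex.Im p`_j * complex.Re p`_k) / (j%:R - k%:R)
       * cos ((j%:R - k%:R) * t))).

Lemma is_derive_fourier r p t :
  is_derive t 1 (fourier_antiderivative r p) (Normc.normc p.[circle_pt r t] ^+ 2).
Proof.
rewrite normc_horner_circle /fourier_antiderivative.
rewrite (_ : (fun _ => _) = \sum_(j < size p) \sum_(k < size p)
  (fun t => r ^+ (j + k) *
    (if j == k then Normc.normc p`_j ^+ 2 * t else
    ((complex.Re p`_j * complex.Re p`_k + complex.Im p`_j * complex.Im p`_k) / (j%:R - k%:R)
       * sin ((j%:R - k%:R) * t) -
     (complex.Re p`_j * complex.Im p`_k - complex.Im p`_j * complex.Re p`_k) / (j%:R - k%:R)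
       * cos ((j%:R - k%:R) * t))))); last first.
  by apply/funext => x; rewrite fct_sumE; apply: eq_bigr => j _; rewrite fct_sumE.
apply: is_derive_sum => j; apply: is_derive_sum => k.
case: eqVneq => [->|jk].
  rewrite subrr mul0r cos0 sin0 mulr0 addr0 mulr1 normc_sqr -!expr2.
  by apply: is_derive_eq; rewrite /GRing.scale /=; ring.
have jk0 : (j%:R - k%:R : R) != 0 by rewrite subr_eq0 eqr_nat.
apply: is_derive_eq; rewrite /GRing.scale /=; field.
exact: jk0.
Qed.

Lemma cos_sin_2piZ (j k : nat) : cos ((j%:R - k%:R) * (2 * pi)) = 1 :> R /\
  sin ((j%:R - k%:R) * (2 * pi)) = 0 :> R.
Proof.
have E n : cos (n%:R * (2 * pi)) = 1 :> R /\ sin (n%:R * (2 * pi)) = 0 :> R.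
  elim: n => [|n [c s]]; first by rewrite mul0r cos0 sin0.
  by rewrite -addn1 natrD mulrDl mul1r cosD sinD c s [2 * pi]mulr_natl cos2pi sin2pi;
     split; ring.
have [cj sj] := E j; have [ck sk] := E k.
by rewrite mulrBl cosB sinB cj sj ck sk; split; ring.
Qed.

Lemma fourier_antiderivative_period r p :
  fourier_antiderivative r p (2 * pi) - fourier_antiderivative r p 0 =
  2 * pi * \sum_(k < size p) Normc.normc p`_k ^+ 2 * r ^+ (2 * k).
Proof.
rewrite /fourier_antiderivative -sumrB big_distrr /=; apply: eq_bigr => j _.
rewrite -sumrB (bigD1 j) //= eqxx big1 ?addr0; last first.
  move=> k kj; rewrite eq_sym (negbTE kj).
  have [-> ->] := cos_sin_2piZ j k.
  by rewrite !mulr0 cos0 sin0; ring.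
by rewrite addnn -mul2n; ring.
Qed.

(** Parseval through the fundamental theorem of calculus: the off-diagonal terms of the
    antiderivative have period 2 pi, so only the linear diagonal terms contribute to its
    increment. *)
Lemma norm2E r p :
  norm2 r p = Num.sqrt (\sum_(k < size p) Normc.normc p`_k ^+ 2 * r ^+ (2 * k)).
Proof.
have pi0 : 0 < 2 * pi :> R by rewrite mulr_gt0 // pi_gt0.
have dF t := is_derive_fourier r p t.
have cF : continuous (fourier_antiderivative r p).
  move=> t; apply: differentiable_continuous; apply/derivable1_diffP.
  exact: (@ex_derive _ _ _ _ _ _ _ (dF t)).
have cf : continuous (fun t => Normc.normc p.[circle_pt r t] ^+ 2).
  move=> t.
  rewrite (_ : (fun _ => _) = \sum_(j < size p) \sum_(k < size p)
    (fun t => r ^+ (j + k) *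
    ((complex.Re p`_j * complex.Re p`_k + complex.Im p`_j * complex.Im p`_k) *
       cos ((j%:R - k%:R) * t) +
     (complex.Re p`_j * complex.Im p`_k - complex.Im p`_j * complex.Re p`_k) *
       sin ((j%:R - k%:R) * t)))).
    apply: differentiable_continuous; apply/derivable1_diffP.
    by apply: derivable_sum => j; apply: derivable_sum => k.
  apply/funext => x; rewrite normc_horner_circle fct_sumE.
  by apply: eq_bigr => j _; rewrite fct_sumE.
congr Num.sqrt.
rewrite /Rintegral (@continuous_FTC2 _ _ (fourier_antiderivative r p)) //=.
- by rewrite fourier_antiderivative_period mulrA mulVf ?mul1r // gt_eqF.
- exact: continuous_subspaceT.
- split=> //.
  + exact/cvg_at_right_filter/cF.
  + exact/cvg_at_left_filter/cF.
- by move=> t _; rewrite derive1E; exact: derive_val.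
Qed.
End parseval.

(** * A dominating function for the squared ratio *)

(** Replacing [(k + 1)^2] by [(k + 1) * (k + 2)] gives the second derivative of the geometric
    series, whose sum is the right-hand side. *)
Lemma sum_sqr_geometric_le (R : realFieldType) (x : R) n : 0 <= x -> x < 1 ->
  \sum_(k < n) k.+1%:R ^+ 2 * x ^+ k <= 2 / (1 - x) ^+ 3.
Proof.
move=> x0 x1.
(* The tail [\sum_(k >= n) (k + 1) * (k + 2) * x ^+ k] in closed form. *)
pose tail n : R := 2 * x ^+ n * (n.+1%:R * n.+2%:R / 2 / (1 - x) +
  n.+2%:R * x / (1 - x) ^+ 2 + x ^+ 2 / (1 - x) ^+ 3).
have s0 : 0 < 1 - x by lra.
have tail_ge0 m : 0 <= tail m.
  have i0 : 0 <= (1 - x)^-1 by rewrite invr_ge0 ltW.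
  rewrite /tail -!exprVn; repeat first [exact: ler0n | done | apply: addr_ge0
    | apply: mulr_ge0 | apply: exprn_ge0].
suff E : \sum_(k < n) (k.+1%:R * k.+2%:R) * x ^+ k + tail n = 2 / (1 - x) ^+ 3.
  rewrite -E; apply: ler_wpDr => //; apply: ler_sum => k _.
  by rewrite expr2 ler_wpM2r ?exprn_ge0 // ler_wpM2l // ler_nat.
have sN0 : 1 - x != 0 by lra.
elim: n => [|n IH].
  by rewrite big_ord0 /tail expr0; field.
rewrite big_ord_recr /= -[RHS]IH -addrA; congr (_ + _).
rewrite /tail exprS -[n.+3]addn3 -[n.+2]addn2 -[n.+1]addn1 !natrD; field.
exact: sN0.
Qed.

(** * The ratio in terms of the coefficients *)

Section polynomials.
Variable R : realType.
Implicit Types (r : R) (b : nat -> R).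

(** For [b k = |a_k|^2] this is [r ^+ 2] times the squared norm of the derivative. The extra factor
    gives numerator and denominator the same weights, so they compare term by term. *)
Definition weighted_num r b n := \sum_(k < n.+1) k%:R ^+ 2 * (b k * r ^+ (2 * k)).

Definition weighted_den r b n := \sum_(k < n.+1) b k * r ^+ (2 * k).

(** The size of a partial sum drops when its leading coefficients vanish; padding with zeros
    restores a summation range that depends on [n] alone. *)
Lemma norm2_le_size r (p : {poly R[i]}) n : (size p <= n)%N ->
  norm2 r p = Num.sqrt (\sum_(k < n) Normc.normc p`_k ^+ 2 * r ^+ (2 * k)).
Proof.
move=> pn; rewrite norm2E; congr Num.sqrt.
rewrite -!(big_mkord xpredT (fun k => Normc.normc p`_k ^+ 2 * r ^+ (2 * k))).
rewrite (big_cat_nat (leq0n _) pn) /= [X in _ + X]big1_seq ?addr0 // => i.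
rewrite mem_index_iota => /andP[_ /andP[pi _]].
by rewrite nth_default // Normc.normc0 expr0n mul0r.
Qed.

Lemma deriv_ratioE r (a : nat -> R[i]) n (b := fun k => Normc.normc (a k) ^+ 2) :
  0 < r -> deriv_ratio r (partial_poly a n) =
  Num.sqrt (weighted_num r b n / weighted_den r b n) / r.
Proof.
move=> r0; set p := partial_poly a n.
have pk k : (k < n.+1)%N -> p`_k = a k by move=> kn; rewrite coef_poly kn.
have np : norm2 r p = Num.sqrt (weighted_den r b n).
  rewrite (norm2_le_size _ (size_poly _ _)); congr Num.sqrt.
  by apply: eq_bigr => k _; rewrite pk.
have ndp : norm2 r p^`() = Num.sqrt (weighted_num r b n) / r.
  rewrite (@norm2_le_size _ _ n); last first.
    have [->|p0] := eqVneq p 0; first by rewrite linear0 size_poly0.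
    by rewrite -ltnS (leq_trans (lt_size_deriv p0)) // size_poly.
  rewrite -[X in _ / X](ger0_norm (ltW r0)) -sqrtr_sqr -sqrtrV ?sqr_ge0 // -sqrtrM; last first.
    apply: sumr_ge0 => k _; apply: (mulr_ge0 (sqr_ge0 _)).
    exact: (mulr_ge0 (sqr_ge0 _) (exprn_ge0 _ (ltW r0))).
  (* The index 0 term vanishes, and the remaining ones, shifted by one, are those of the
     derivative. *)
  congr Num.sqrt; rewrite /weighted_num big_ord_recl /= expr0n mul0r add0r big_distrl /=.
  apply: eq_bigr => k _; rewrite coef_deriv pk ?ltnS ?ltn_ord //.
  rewrite -[a _ *+ _]mulr_natl /bump /= add1n Normc.normcM /b exprMn.
  have -> : Normc.normc (k.+1%:R : R[i]) = k.+1%:R.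
    by rewrite -[LHS]/(Normc.normc (k.+1%:R : Rcomplex R)) normcMn Normc.normc1.
  have rN0 : r != 0 by rewrite gt_eqF.
  by rewrite mulnS exprD; field.
rewrite /deriv_ratio ndp np; case: eqVneq => p0.
  (* The convention for the zero polynomial agrees with the value 0 of the inverse at 0. *)
  have -> : weighted_den r b n = 0.
    apply: big1 => k _; rewrite /b -pk ?p0 ?coef0 ?ltn_ord //.
    by rewrite Normc.normc0 expr0n mul0r.
  by rewrite invr0 mulr0 sqrtr0 mul0r.
rewrite sqrtrM ?sqrtrV; first by rewrite mulrAC.
- apply: sumr_ge0 => k _.
  exact: (mulr_ge0 (sqr_ge0 _) (exprn_ge0 _ (ltW r0))).
- apply: sumr_ge0 => k _; apply: (mulr_ge0 (sqr_ge0 _)).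
  exact: (mulr_ge0 (sqr_ge0 _) (exprn_ge0 _ (ltW r0))).
Qed.

End polynomials.

(** * Bound and limit along a fixed sequence *)

Section domination.
Variables (R : realType) (r delta : R) (b : nat -> R).
Hypotheses (r_gt0 : 0 < r) (delta_gt0 : 0 < delta).
Hypothesis b_ge0 : forall k, 0 <= b k.
Local Notation num := (weighted_num r b).
Local Notation den := (weighted_den r b).

Let term_ge0 k : 0 <= b k * r ^+ (2 * k).
Proof. by rewrite mulr_ge0 // exprn_ge0 // ltW. Qed.

Lemma num_ge0 n : 0 <= num n.
Proof. by apply: sumr_ge0 => k _; rewrite mulr_ge0 ?sqr_ge0. Qed.

Lemma den_ge0 n : 0 <= den n.
Proof. exact: sumr_ge0. Qed.

Lemma num_nondecreasing : nondecreasing_seq num.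
Proof.
apply/nondecreasing_seqP => n.
by rewrite /weighted_num [leRHS]big_ord_recr /= lerDl mulr_ge0 ?sqr_ge0.
Qed.

Lemma den_nondecreasing : nondecreasing_seq den.
Proof.
by apply/nondecreasing_seqP => n; rewrite /weighted_den [leRHS]big_ord_recr /= lerDl.
Qed.

Lemma term_le_den k : b k * r ^+ (2 * k) <= den k.
Proof. by rewrite /weighted_den big_ord_recr /= lerDr; exact: sumr_ge0. Qed.

Lemma term_le_num k : (0 < k)%N -> b k * r ^+ (2 * k) <= num k.
Proof.
move=> k0; rewrite /weighted_num big_ord_recr /=; apply: ler_wpDl.
  by apply: sumr_ge0 => i _; rewrite mulr_ge0 ?sqr_ge0.
by rewrite ler_peMl // -natrX ler1n expn_gt0 k0.
Qed.

Lemma num_le_den n : num n <= n.+1%:R ^+ 2 * den n.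
Proof.
rewrite /weighted_den big_distrr /=; apply: ler_sum => k _.
by rewrite ler_wpM2r // -!natrX ler_nat leq_exp2r // ltnW.
Qed.

(** Only index 0 escapes [1 <= k^2]. A bound on the numerators therefore bounds the denominators
    too. *)
Lemma den_le_num n : den n <= b 0%N + num n.
Proof.
rewrite /weighted_den /weighted_num !big_ord_recl /=.
rewrite muln0 expr0 mulr1 expr0n mul0r add0r lerD2l.
by apply: ler_sum => k _; rewrite ler_peMl // -natrX ler1n expn_gt0.
Qed.

(* [small_until t] is the event [tau > t].  The hitting time [tau] skips index 0,
   since [b 0] does not contribute to the numerator, whose limit must be > 0. *)
Definition small_until t := [forall i : 'I_t, b i.+1 < delta].

(* The bound for [tau = t + 1], with [(t + 2 + i)^2] weakened to
   [(t + 2)^2 * (i + 1)^2] so that [t] and [i] separate. *)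
Definition dominating_term t j : R := (small_until t)%:R * (t.+2%:R ^+ 2 *
  if j is i.+1 then delta^-1 * (i.+1%:R ^+ 2 * r ^+ (2 * i.+1) * b (t.+2 + i)) else 1).

Definition dominating : \bar R :=
  (\sum_(0 <= t <oo) \sum_(0 <= j <oo) (dominating_term t j)%:E)%E.

Lemma dominating_term_ge0 t j : 0 <= dominating_term t j.
Proof.
rewrite /dominating_term !mulr_ge0 ?sqr_ge0 //; case: j => // i.
by rewrite !mulr_ge0 ?invr_ge0 ?sqr_ge0 ?exprn_ge0 // ltW.
Qed.

(** The term of index [t + 2 + m] is absorbed because [t + 2 + m <= (t + 2) * (m + 1)]. The factor
    pulled out, [delta * r ^+ (2 * t.+1)], is the lower bound for the denominator after a hit at
    [t + 1]. *)
Lemma num_le_partial t m : small_until t ->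
  num (t.+1 + m) <= num t.+1 +
    delta * r ^+ (2 * t.+1) * \sum_(j < m) dominating_term t j.+1.
Proof.
move=> st; elim: m => [|m IH]; first by rewrite addn0 big_ord0 mulr0 addr0.
rewrite addnS {1}/weighted_num big_ord_recr /= -/(weighted_num r b (t.+1 + m)).
rewrite [in leRHS](big_ord_recr m) /= mulrDr addrA.
apply: lerD => //; rewrite /dominating_term st mul1r -addSn.
have -> : delta * r ^+ (2 * t.+1) * (t.+2%:R ^+ 2 *
   (delta^-1 * (m.+1%:R ^+ 2 * r ^+ (2 * m.+1) * b (t.+2 + m)))) =
   (t.+2 * m.+1)%:R ^+ 2 * (b (t.+2 + m) * r ^+ (2 * (t.+2 + m))).
  have dN0 : delta != 0 by rewrite gt_eqF.
  rewrite addSnnS mulnDr exprD natrM -addSnnS; field; exact: dN0.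
rewrite ler_wpM2r // -!natrX ler_nat leq_exp2r //.
by rewrite mulnS leq_add2l mulSn leq_addr.
Qed.

Lemma partial_le_dominating t n :
  ((\sum_(j < n) dominating_term t j)%:E <= dominating)%E.
Proof.
have h0 s j : (0 <= (dominating_term s j)%:E)%E by rewrite lee_fin dominating_term_ge0.
apply: (@le_trans _ _ (\sum_(0 <= j <oo) (dominating_term t j)%:E)%E).
  by rewrite -sumEFin -(big_mkord xpredT (fun j => (dominating_term t j)%:E));
    exact: nneseries_lim_ge.
apply: (@le_trans _ _ (\sum_(0 <= s < t.+1) \sum_(0 <= j <oo) (dominating_term s j)%:E)%E).
  rewrite big_nat_recr //= leeDr //; apply: sume_ge0 => s _; exact: nneseries_ge0.
by apply: nneseries_lim_ge => s _ _; exact: nneseries_ge0.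
Qed.

(** Without a hit every row [t] of the double series stays active and contributes at least 1 through
    its entry [j = 0], so the series diverges. Almost sure finiteness of the hitting time thus comes
    with integrability of the bound. *)
Lemma dominating_ltoo_hit : (dominating < +oo)%E ->
  exists2 t, small_until t & delta <= b t.+1.
Proof.
move=> Goo; apply: contrapT => /forall2NP nohit.
have st t : small_until t.
  elim: t => [|t IH]; first by apply/forallP => -[].
  have bt : b t.+1 < delta by have [/(_ IH)//|/negP] := nohit t; rewrite -ltNge.
  apply/forallP => i; have := ltn_ord i; rewrite ltnS leq_eqVlt => /orP[/eqP ->//|it].
  by have /forallP/(_ (Ordinal it)) := IH.
have h0 s j : (0 <= (dominating_term s j)%:E)%E by rewrite lee_fin dominating_term_ge0.
have G_ge n : (n%:R%:E <= dominating)%E.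
  apply: (@le_trans _ _ (
    \sum_(0 <= s < n) \sum_(0 <= j <oo) (dominating_term s j)%:E)%E); last first.
    by apply: nneseries_lim_ge => s _ _; exact: nneseries_ge0.
  have -> : (n%:R%:E = \sum_(0 <= s < n) 1%:E :> \bar R)%E.
    by rewrite sumEFin sumr_const_nat subn0.
  apply: lee_sum => s _.
  apply: (@le_trans _ _ (\sum_(0 <= j < 1) (dominating_term s j)%:E)%E).
    by rewrite big_nat1 lee_fin /dominating_term st mul1r mulr1 -natrX ler1n expn_gt0.
  exact: nneseries_lim_ge.
have Gfin : dominating \is a fin_num.
  by rewrite ge0_fin_numE //; exact: (G_ge 0%N).
have := G_ge (Num.bound (fine dominating)).
rewrite -(fineK Gfin) lee_fin leNgt => /negP; apply.
by apply: archi_boundP; rewrite fine_ge0 // (G_ge 0%N).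
Qed.

Lemma ratio_le_dominating n : ((num n / den n)%:E <= dominating)%E.
Proof.
have [Goo|] := ltP dominating +oo%E; last first.
  by rewrite leye_eq => /eqP ->; exact: leey.
have [t st bt] := dominating_ltoo_hit Goo.
apply: le_trans (partial_le_dominating t n.+1).
rewrite lee_fin big_ord_recl /= {1}/dominating_term st mul1r mulr1.
(* A vanishing denominator makes the quotient 0. *)
have [->|dN0] := eqVneq (den n) 0.
  rewrite invr0 mulr0 addr_ge0 ?sqr_ge0 //.
  by apply: sumr_ge0 => j _; exact: dominating_term_ge0.
have d_gt0 : 0 < den n by rewrite lt0r dN0 den_ge0.
rewrite ler_pdivrMr //.
have sum0 k : 0 <= \sum_(j < k) dominating_term t j.+1.
  by apply: sumr_ge0 => j _; exact: dominating_term_ge0.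
(* Up to the hit the denominator may be arbitrarily small, but every [k^2] is at most [(t + 2)^2],
   which is the entry [j = 0]. *)
have [nt|tn] := leqP n t.+1.
  apply: le_trans (num_le_den n) _; rewrite mulrDl ler_wpDr ?mulr_ge0 ?den_ge0 ?sum0 //.
  by rewrite ler_wpM2r ?den_ge0 // -!natrX ler_nat leq_exp2r.
rewrite -(subnKC (ltnW tn)); set m := (n - t.+1)%N.
apply: le_trans (num_le_partial m st) _.
rewrite mulrDl; apply: lerD.
  apply: le_trans (num_le_den _) _; rewrite ler_wpM2l ?sqr_ge0 //.
  by apply: den_nondecreasing; rewrite leq_addr.
rewrite mulrC; apply: ler_pM => //.
- by rewrite mulr_ge0 ?exprn_ge0 // ltW.
- rewrite (big_ord_widen (t.+1 + m) (fun j => dominating_term t j.+1) (leq_addl _ _)).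
  rewrite [leRHS](bigID (fun i : 'I__ => (i < m)%N)) /= ler_wpDr //.
  by apply: sumr_ge0 => j _; exact: dominating_term_ge0.
(* The hit [delta <= b t.+1] keeps the denominator away from 0. *)
- apply: (@le_trans _ _ (den t.+1)).
    by apply: le_trans (term_le_den _); rewrite ler_wpM2r // exprn_ge0 // ltW.
  by apply: den_nondecreasing; rewrite leq_addr.
Qed.

(** Both sums are nondecreasing and bounded. Their limits are positive because the hit occurs at an
    index at least 1, which counts in both. *)
Lemma ratio_cvg : (dominating < +oo)%E ->
  exists2 l : R, 0 < l & num n / den n @[n --> \oo] --> l.
Proof.
move=> Goo; have [t st bt] := dominating_ltoo_hit Goo.
have Gfin : dominating \is a fin_num.
  by rewrite ge0_fin_numE //; apply: le_trans (partial_le_dominating 0 0); rewrite big_ord0.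
have pos : 0 < b t.+1 * r ^+ (2 * t.+1).
  by rewrite mulr_gt0 ?exprn_gt0 // (lt_le_trans delta_gt0).
(* Row 0 carries no condition, [small_until 0] being vacuous, so it controls the whole numerator
   series. *)
have num_ub n : num n <= num 1 + delta * r ^+ 2 * fine dominating.
  apply: (@le_trans _ _ (num (1 + n))); first by apply: num_nondecreasing; rewrite leq_addl.
  have s0 : small_until 0 by apply/forallP => -[].
  apply: le_trans (num_le_partial n s0) _; rewrite lerD2l muln1.
  apply: ler_wpM2l; first by rewrite mulr_ge0 ?exprn_ge0 // ltW.
  rewrite -lee_fin fineK //.
  apply: le_trans (partial_le_dominating 0 n.+1).
  by rewrite lee_fin [leRHS]big_ord_recl lerDr dominating_term_ge0.
have num_cvg : cvgn num.
  apply: nondecreasing_is_cvgn num_nondecreasing _.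
  by exists (num 1 + delta * r ^+ 2 * fine dominating) => _ [n _ <-].
have den_cvg : cvgn den.
  apply: nondecreasing_is_cvgn den_nondecreasing _.
  exists (b 0%N + (num 1 + delta * r ^+ 2 * fine dominating)) => _ [n _ <-].
  by apply: le_trans (den_le_num n) _; rewrite lerD2l.
have num_lim_gt0 : 0 < limn num.
  apply: lt_le_trans pos _; apply: le_trans (term_le_num (ltn0Sn t)) _.
  exact: nondecreasing_cvgn_le num_nondecreasing num_cvg _.
have den_lim_gt0 : 0 < limn den.
  apply: lt_le_trans pos _; apply: le_trans (term_le_den t.+1) _.
  exact: nondecreasing_cvgn_le den_nondecreasing den_cvg _.
exists (limn num / limn den); first exact: divr_gt0.
by apply: cvgM => //; apply: cvgV => //; rewrite gt_eqF.
Qed.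

End domination.

(** * Independence *)

Lemma nneseries_le_bound (R : realType) (u : nat -> R) (M : R) :
  (forall k, 0 <= u k) -> (forall n, \sum_(k < n) u k <= M) ->
  (\sum_(0 <= k <oo) (u k)%:E <= M%:E)%E.
Proof.
move=> u0 uM; apply: lime_le; first by apply: is_cvg_nneseries => k _ _; rewrite lee_fin.
by apply: nearW => n; rewrite sumEFin lee_fin big_mkord.
Qed.

(** The topology of [R[i]^o] comes from the [R[i]]-valued norm, so a real radius [e] is passed
    through [e%:C]. This yields Borel measurability of the squared modulus. *)
Lemma continuous_normc (R : realType) :
  continuous (fun z : R[i]^o => Normc.normc (z : R[i]) : R).
Proof.
move=> x; apply/(@cvgrPdist_lt _ _ _ _ (@nbhs_filter R[i]^o x)) => e e0.
have e0C : 0 < e%:C :> R[i] by rewrite ltcR.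
apply: (@filterS _ _ (@nbhs_filter R[i]^o x)) (@nbhsx_ballx _ (R[i]^o) x _ e0C) => y /= xy.
have nE (z : R[i]) : `|z| = (Normc.normc z)%:C by case: z => u v; rewrite normc_def.
have nB (u v : R[i]) : Normc.normc u - Normc.normc v <= Normc.normc (u - v).
  by rewrite -lecR raddfB /= -!nE lerB_dist.
have {}xy : Normc.normc (x - y : R[i]) < e by rewrite -ltcR -nE.
have [nC] : (Normc.normc (y - x : R[i]))%:C = (Normc.normc (x - y : R[i]))%:C.
  by rewrite -!nE distrC.
have := nB x y; have := nB y x; rewrite nC ltr_norml => yx xy'.
apply/andP; split; lra.
Qed.

Lemma measurable_normc_sqr (R : realType) :
  measurable_fun [set: borelC R] (fun z : borelC R => Normc.normc (z : R[i]) ^+ 2).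
Proof.
apply: measurable_funX.
apply: (measurability _ (RGenOInfty.measurableE R)).
move=> _ [_ [x ->] <-]; rewrite setTI; apply: sub_sigma_algebra.
by apply: open_comp => [z _|]; [exact: continuous_normc|exact: itv_open_ends_open].
Qed.

Section probability.
Context d (T : measurableType d) (R : realType) (P : probability T R).

(** Otherwise each event [1/(n+1) <= f] would be null, hence also their union, the event that [f] is
    nonzero. *)
Lemma exists_small_lt1 (f : T -> R) : measurable_fun setT f -> (forall w, 0 <= f w) ->
  (P [set w | f w = 0%R] < 1)%E ->
  exists2 delta, 0 < delta & (P [set w | (f w < delta)%R] < 1)%E.
Proof.
move=> mf f0 Pf; apply: contrapT => /forall2NP H.
have mlt (e : R) : measurable [set w | f w < e].
  rewrite (_ : [set _ | _] = f @^-1` [set x | x < e]) //.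
  by rewrite -[_ @^-1` _]setTI; apply: mf => //; rewrite -set_itvNyo.
have m0 : measurable [set w | f w = 0].
  by rewrite -[X in measurable X]setTI; exact: (mf measurableT [set 0]).
have N n : P.-negligible [set w | n.+1%:R^-1 <= f w].
  have -> : [set w | n.+1%:R^-1 <= f w] = ~` [set w | f w < n.+1%:R^-1].
    by apply/seteqP; split=> w /=; rewrite leNgt => /negP.
  apply/negligibleP; first exact: measurableC.
  have [H1|/negP] := H n.+1%:R^-1; first by case: H1; rewrite invr_gt0 ltr0n.
  rewrite -leNgt => P1.
  have P1' : (P [set w | (f w < n.+1%:R^-1)%R] = 1)%E.
    by apply/eqP; rewrite eq_le P1 probability_le1.
  have -> : (0 = 1 - P [set w | (f w < n.+1%:R^-1)%R])%E by rewrite P1' subee.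
  exact: probability_setC.
have := negligible_bigcup N.
have -> : \bigcup_n [set w | n.+1%:R^-1 <= f w] = ~` [set w | f w = 0].
  apply/seteqP; split=> w /=.
    by move=> [n _ /= nf] fw0; move: nf; rewrite fw0 leNgt invr_gt0 ltr0n.
  move=> /eqP fN0; exists (Num.bound (f w)^-1) => //=.
  have fw0 : 0 < f w by rewrite lt0r fN0 f0.
  rewrite -[leRHS]invrK lef_pV2 ?posrE ?invr_gt0 ?ltr0n //.
  apply: ltW; apply: lt_le_trans (archi_boundP _) _; first by rewrite invr_ge0.
  by rewrite ler_nat.
move=> /(negligibleP _ (measurableC m0)) PC.
have P1 : (1 = P [set w | f w = 0%R])%E.
  have := probability_setC P (measurableC m0); rewrite setCK => ->.
  by rewrite [X in (_ - X)%E]PC sube0.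
by move: Pf; rewrite -P1 ltxx.
Qed.

Context d' (T' : measurableType d').

(* Restricting [P] to [E] multiplies the law of [X] by the constant [c]. *)
Lemma ge0_integral_indep (E : set T) (X : {RV P >-> T'}) (c : R) (f : T' -> \bar R) :
  measurable E -> 0 <= c ->
  (forall B, measurable B -> P (E `&` X @^-1` B) = (c%:E * P (X @^-1` B))%E) ->
  measurable_fun setT f -> (forall z, 0 <= f z)%E ->
  (\int[P]_(w in E) f (X w) = c%:E * \int[P]_w f (X w))%E.
Proof.
move=> mE c0 EX mf f0.
have mX : measurable_fun setT X by [].
transitivity (\int[pushforward (mrestr P mE) X]_z f z)%E.
  rewrite ge0_integral_pushforward // preimage_setT.
  transitivity (\int[mrestr P mE]_(w in E) f (X w))%E.
    by apply: eq_measure_integral => B mB BE; rewrite /= /mrestr setIidl.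
  rewrite [RHS](@ge0_negligible_integral _ _ _ _ _ (~` E)) ?setTD ?setCK //.
  - exact: measurableC.
  - exact: measurableT_comp.
  - by move=> w _; exact: f0.
  - by rewrite /= /mrestr setICl measure0.
transitivity (\int[mscale (NngNum c0) (distribution P X)]_z f z)%E.
  by apply: eq_measure_integral => B mB _; rewrite /= /pushforward /mrestr setIC EX.
by rewrite ge0_integral_mscale // ge0_integral_pushforward // preimage_setT.
Qed.

Section iid_sequence.
Variable A : nat -> {RV P >-> T'}.
Hypothesis A_indep : mutually_independent P (fun k => A k : T -> T').
Hypothesis A_ident : identically_distributed A.
Variables (S : set T') (q : R).
Hypotheses (mS : measurable S) (PS : P (A 0%N @^-1` S) = q%:E).

Let preimage_ident k (B : set T') : measurable B -> P (A k @^-1` B) = P (A 0%N @^-1` B).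
Proof. by move=> mB; exact: (A_ident k 0%N mB). Qed.

Definition staying t := [set w | forall i, (i < t)%N -> S (A i.+1 w)].

Lemma measurable_staying t : measurable (staying t).
Proof.
rewrite (_ : staying t = \bigcap_(i in `I_t) (A i.+1 @^-1` S)); last by apply/seteqP; split.
by apply: bigcap_measurableType => // i _; rewrite -[_ @^-1` _]setTI; exact: measurable_funP.
Qed.

(** Mutual independence is applied to the indices [1, ..., t] together with [k]; each of the first
    [t] factors equals [q] by identical distribution. *)
Lemma prob_staying t k B : (t < k)%N -> measurable B ->
  P (staying t `&` A k @^-1` B) = ((q ^+ t)%:E * P (A k @^-1` B))%E.
Proof.
move=> tk mB; pose J := seq_fset tt (iota 1 t).
have kJ : k \notin J by rewrite seq_fsetE mem_iota add1n ltnS [(k <= t)%N]leqNgt tk andbF.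
pose C i := if i == k then B else S.
have mC i : measurable (C i) by rewrite /C; case: ifP.
have := A_indep (k |` J)%fset mC.
rewrite bigcap_fsetU1 big_fsetU1 //= {1 3}/C eqxx muleC.
have -> : \bigcap_(i in [set` J]) (A i @^-1` C i) = staying t.
  apply/seteqP; split=> w /= Hw.
    move=> i it; have := Hw i.+1; rewrite /C /= seq_fsetE mem_iota add1n !ltnS leq0n it.
    by rewrite ltn_eqF ?(leq_ltn_trans it) //; exact.
  move=> [|i] /=; rewrite seq_fsetE mem_iota // add1n !ltnS leq0n /= => it.
  by rewrite /C ltn_eqF ?(leq_ltn_trans it) //; exact: Hw.
rewrite setIC => ->; congr (_ * _)%E.
have permJ : perm_eq J (iota 1 t).
  by rewrite -[X in perm_eq _ X]undup_id ?iota_uniq // seq_fset_perm.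
rewrite (perm_big _ permJ) /=.
rewrite (eq_big_seq (fun => q%:E)) => [|i]; last first.
  rewrite mem_iota add1n ltnS => /andP[_ it].
  by rewrite /C ltn_eqF ?(leq_ltn_trans it) // preimage_ident.
by rewrite prodEFin big_const_seq count_predT size_iota iter_mulr_1.
Qed.

(** As [t < k], the event is independent of [A k], whose law is then exchanged for that of [A 0]. *)
Lemma integral_staying (f : T' -> R) (c : R) t k : (t < k)%N -> 0 <= c ->
  measurable_fun setT f -> (forall z, 0 <= f z) ->
  (\int[P]_w (\1_(staying t) w * (c * f (A k w)))%:E =
   (c * q ^+ t)%:E * \int[P]_w (f (A 0%N w))%:E)%E.
Proof.
move=> tk c0 mf f0.
have q0 : 0 <= q by rewrite -lee_fin -PS.
have mfE : measurable_fun setT (fun z => (f z)%:E) by exact/measurable_EFinP.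
transitivity (c%:E * \int[P]_(w in staying t) (f (A k w))%:E)%E.
  rewrite -ge0_integralZl //.
  - rewrite [RHS]integral_mkcond; apply: eq_integral => w _.
    by rewrite patchE indicE; case: ifPn => _; rewrite ?mul1r ?mul0r.
  - exact: measurable_staying.
  - by apply: measurable_funTS; exact: (measurableT_comp mfE).
  - by move=> w _; rewrite lee_fin.
rewrite (@ge0_integral_indep _ _ (q ^+ t) (fun z => (f z)%:E)) ?exprn_ge0 //.
- rewrite EFinM muleA; congr (_ * _)%E.
  transitivity (\int[distribution P (A k)]_z (f z)%:E)%E.
    by rewrite ge0_integral_distribution // => z; rewrite lee_fin.
  rewrite (eq_measure_integral (distribution P (A 0%N))).
    by rewrite ge0_integral_distribution // => z; rewrite lee_fin.
  by move=> B mB _; exact: A_ident.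
- exact: measurable_staying.
- by move=> B mB; exact: prob_staying.
Qed.

End iid_sequence.
End probability.

(** * Integrability of the dominating function *)

Section dominating_expectation.
Context d (T : measurableType d) (R : realType) (P : probability T R).
Variables (r delta : R) (A : nat -> {RV P >-> borelC R}).
Hypotheses (r_gt0 : 0 < r) (r_lt1 : r < 1) (delta_gt0 : 0 < delta).
Hypothesis A_indep : mutually_independent P (fun k => A k : T -> borelC R).
Hypothesis A_ident : identically_distributed A.

Let b (w : T) k : R := Normc.normc (A k w : R[i]) ^+ 2.

Lemma measurable_normc_sqr_RV k : measurable_fun setT (b ^~ k).
Proof. exact: (measurableT_comp (@measurable_normc_sqr R)). Qed.

Hypothesis Pdelta : (P [set w | (b w 0%N < delta)%R] < 1)%E.
Hypothesis b_integrable : (\int[P]_w (b w 0%N)%:E < +oo)%E.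

Let S : set (borelC R) := [set z | Normc.normc (z : R[i]) ^+ 2 < delta].

Let mS : measurable S.
Proof.
rewrite (_ : S = (fun z : borelC R => Normc.normc (z : R[i]) ^+ 2) @^-1` [set x | x < delta]) //.
by rewrite -[_ @^-1` _]setTI; apply: measurable_normc_sqr => //; rewrite -set_itvNyo.
Qed.

(** The part of [dominating_term t j] that depends on the single variable of index [t + 1 + j]; the
    constant at [j = 0] lets [integral_staying] treat all [j] alike. *)
Let factor j (z : borelC R) : R :=
  if j is i.+1 then delta^-1 * (i.+1%:R ^+ 2 * r ^+ (2 * i.+1) * Normc.normc (z : R[i]) ^+ 2)
  else 1.

Let factor_ge0 j z : 0 <= factor j z.
Proof.
case: j => //= j; rewrite mulr_ge0 ?invr_ge0 ?(ltW delta_gt0) //.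
by rewrite mulr_ge0 ?sqr_ge0 // mulr_ge0 ?sqr_ge0 // exprn_ge0 // ltW.
Qed.

Let measurable_factor j : measurable_fun setT (factor j).
Proof.
case: j => [|j]; first exact: measurable_cst.
apply: measurable_funM; first exact: measurable_cst.
by apply: measurable_funM; [exact: measurable_cst|exact: measurable_normc_sqr].
Qed.

Let dominating_termE t j w : dominating_term r delta (b w) t j =
  \1_(staying A S t) w * (t.+2%:R ^+ 2 * factor j (A (t.+1 + j) w)).
Proof.
rewrite /dominating_term; congr (_ * (_ * _)).
  rewrite indicE; congr (_%:R); congr nat_of_bool; apply/forallP/idP.
    by move=> H; apply/mem_set => i it; exact: (H (Ordinal it)).
  by move=> /set_mem H i; exact: H.
by case: j => //= j; rewrite addnS.
Qed.

Let measurable_dominating_term t j :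
  measurable_fun setT (fun w => (dominating_term r delta (b w) t j)%:E).
Proof.
under eq_fun do rewrite dominating_termE.
apply/measurable_EFinP; apply: measurable_funM.
  exact: measurable_indic (measurable_staying A mS t).
apply: measurable_funM; first exact: measurable_cst.
exact: (measurableT_comp (measurable_factor j)).
Qed.

Let b_ge0 w k : 0 <= b w k. Proof. exact: sqr_ge0. Qed.

Let dominating_term_ge0E t j w : (0 <= (dominating_term r delta (b w) t j)%:E)%E.
Proof. by rewrite lee_fin dominating_term_ge0. Qed.

Let measurable_inner t :
  measurable_fun setT (fun w => \sum_(0 <= j <oo) (dominating_term r delta (b w) t j)%:E)%E.
Proof. by apply: (@ge0_emeasurable_sum _ _ _ _ _ xpredT). Qed.

Lemma measurable_dominating : measurable_fun setT (fun w => dominating r delta (b w)).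
Proof.
apply: (@ge0_emeasurable_sum _ _ _ _ _ xpredT) => // t w _ _.
exact: nneseries_ge0.
Qed.

Let q := fine (P (A 0%N @^-1` S)).

Let qE : P (A 0%N @^-1` S) = q%:E.
Proof.
rewrite fineK // fin_num_measure // -[_ @^-1` _]setTI.
exact: measurable_funP.
Qed.

Let m := fine (\int[P]_w (b w 0%N)%:E)%E.

Let mE : (\int[P]_w (b w 0%N)%:E)%E = m%:E.
Proof. by rewrite fineK // ge0_fin_numE // integral_ge0 // => w _; rewrite lee_fin. Qed.

Let factor_mean j := if j is i.+1 then m / delta * (i.+1%:R ^+ 2 * (r ^+ 2) ^+ i.+1) else 1.

Let integral_factor j : (\int[P]_w (factor j (A 0%N w))%:E)%E = (factor_mean j)%:E.
Proof.
case: j => [|j] /=.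
  by rewrite -[RHS](probability_setT P) -[RHS]mul1e -(integral_cst P measurableT).
set c := delta^-1 * (j.+1%:R ^+ 2 * r ^+ (2 * j.+1)).
transitivity (\int[P]_w (c%:E * (b w 0%N)%:E))%E.
  by apply: eq_integral => w _; rewrite -EFinM /c mulrA.
rewrite ge0_integralZl //.
- by rewrite mE -EFinM /c -exprM; congr EFin; ring.
- by apply/measurable_EFinP; exact: measurable_normc_sqr_RV.
- by move=> w _; rewrite lee_fin.
- rewrite lee_fin /c mulr_ge0 ?invr_ge0 ?(ltW delta_gt0) //.
  by rewrite mulr_ge0 ?sqr_ge0 // exprn_ge0 // ltW.
Qed.

(** Integrating term by term splits entry [(t, j)] into [(t + 2)^2 * q^t] and the mean of
    [factor j]. Both sums are of the type in [sum_sqr_geometric_le], with ratios [q] and [r ^+ 2],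
    each below 1. *)
Lemma integral_dominating : (\int[P]_w dominating r delta (b w) < +oo)%E.
Proof.
have q0 : 0 <= q by rewrite -lee_fin -qE.
have q1 : q < 1 by rewrite -lte_fin -qE.
have m0 : 0 <= m by rewrite -lee_fin -mE integral_ge0 // => w _; rewrite lee_fin.
have x0 : 0 <= r ^+ 2 := sqr_ge0 r.
have x1 : r ^+ 2 < 1 by rewrite expr_lt1 // ltW.
have fm0 j : 0 <= factor_mean j.
  by rewrite -lee_fin -integral_factor integral_ge0 // => w _; rewrite lee_fin.
have md0 : 0 <= m / delta by rewrite divr_ge0 // ltW.
(* The 1 is the entry [j = 0]; in the others one factor [r ^+ 2 <= 1] is dropped to match the
   geometric bound. *)
pose B := 1 + m / delta * (2 / (1 - r ^+ 2) ^+ 3).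
have sum_fm : (\sum_(0 <= j <oo) (factor_mean j)%:E <= B%:E)%E.
  apply: nneseries_le_bound => // -[|n].
    rewrite big_ord0 addr_ge0 // mulr_ge0 // divr_ge0 // exprn_ge0 // subr_ge0; exact: ltW.
  rewrite big_ord_recl lerD2l /= -big_distrr /= ler_wpM2l //.
  apply: le_trans (sum_sqr_geometric_le n x0 x1); apply: ler_sum => k _.
  by rewrite ler_wpM2l ?sqr_ge0 // exprS ler_piMl ?exprn_ge0 // ltW.
have B0 : 0 <= B.
  rewrite -lee_fin (le_trans _ sum_fm) // nneseries_ge0 // => j _ _.
  by rewrite lee_fin.
rewrite /dominating integral_nneseries //; last by move=> t w _; exact: nneseries_ge0.
(* The 4 comes from [t + 2 <= 2 * (t + 1)], which aligns the sum over [t] with the geometric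
   bound. *)
have inner t : (\int[P]_w \sum_(0 <= j <oo) (dominating_term r delta (b w) t j)%:E <=
    (4 * (t.+1%:R ^+ 2 * q ^+ t) * B)%:E)%E.
  rewrite integral_nneseries //.
  rewrite (eq_eseriesr
    (g := fun j => ((t.+2%:R ^+ 2 * q ^+ t)%:E * (factor_mean j)%:E)%E)); last first.
    move=> j _; rewrite -integral_factor.
    rewrite -(integral_staying A_indep A_ident mS qE (k := t.+1 + j)) ?sqr_ge0 //; last first.
      by rewrite addSn ltnS leq_addr.
    by apply: eq_integral => w _; rewrite dominating_termE.
  rewrite nneseriesZl; last by move=> j _; rewrite lee_fin.
  have c0 : 0 <= t.+2%:R ^+ 2 * q ^+ t by rewrite mulr_ge0 ?sqr_ge0 ?exprn_ge0.
  apply: (@le_trans _ _ ((t.+2%:R ^+ 2 * q ^+ t)%:E * B%:E)%E).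
    by apply: lee_wpmul2l; rewrite ?lee_fin.
  rewrite -EFinM lee_fin ler_wpM2r // mulrA ler_wpM2r ?exprn_ge0 //.
  rewrite -!natrX -natrM ler_nat -(expnMn 2 _ 2) leq_exp2r // mul2n -addnn.
  by rewrite addSn addnS !ltnS leq_addr.
apply: (@le_lt_trans _ _ (\sum_(0 <= t <oo) (4 * (t.+1%:R ^+ 2 * q ^+ t) * B)%:E)%E).
  apply: lee_nneseries => // t _ _; apply: integral_ge0 => w _.
  exact: nneseries_ge0.
apply: (@le_lt_trans _ _ (4 * (2 / (1 - q) ^+ 3) * B)%:E); last exact: ltry.
apply: nneseries_le_bound => [t|n].
  by rewrite !mulr_ge0 ?sqr_ge0 ?exprn_ge0.
rewrite -big_distrl -big_distrr /= ler_wpM2r // ler_wpM2l //.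
exact: sum_sqr_geometric_le.
Qed.

End dominating_expectation.

(** * Almost sure and L1 convergence *)

(** Inversion is discontinuous at 0; on nonnegative reals it is the power -1, also at 0, where both
    are 0, and real powers are measurable. *)
Lemma measurable_sqrt_ratio d (T : measurableType d) (R : realType) (f g : T -> R) :
  measurable_fun setT f -> measurable_fun setT g ->
  (forall w, 0 <= f w) -> (forall w, 0 <= g w) ->
  measurable_fun setT (fun w => Num.sqrt (f w / g w)).
Proof.
move=> mf mg f0 g0.
rewrite (_ : (fun _ => _) = fun w => (f w * g w `^ (-1)) `^ 2^-1); last first.
  by apply/funext => w; rewrite powR_inv1 // powR12_sqrt // divr_ge0.
apply: (measurableT_comp (measurable_powR _)).
by apply: measurable_funM => //; exact: (measurableT_comp (measurable_powR _)).
Qed.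

Theorem proposition4 (R : realType) (d : measure_display)
    (T : measurableType d) (P : probability T R)
    (r : R) (r_gt0 : 0 < r) (r_lt1 : r < 1)
    (A : nat -> {RV P >-> borelC R})
    (A_indep : mutually_independent P (fun k => A k : T -> borelC R))
    (A_ident : identically_distributed A)
    (A0_nontrivial : (P [set w | (A 0%N w : R[i]) = 0%R] < 1)%E)
    (A0_L2 : ('E_P[fun w => (Normc.normc (A 0%N w : R[i]) ^+ 2)%R] < +oo)%E) :
  let ratio (n : nat) (w : T) : R :=
    deriv_ratio r (partial_poly (fun k => A k w : R[i]) n) in
  exists X : {RV P >-> R},
    [/\ forall w, 0 < X w,
        {ae P, forall w, ratio n w @[n --> \oo] --> X w},
        ('E_P[ratio n])%E @[n --> \oo] --> ('E_P[X])%E &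
        ('E_P[X] < +oo)%E].
Proof.
move=> ratio.
pose b (w : T) k : R := Normc.normc (A k w : R[i]) ^+ 2.
have b0 w k : 0 <= b w k by exact: sqr_ge0.
have mb k : measurable_fun setT (b ^~ k) by exact: measurable_normc_sqr_RV.
have [delta delta0 Pdelta] :
    exists2 delta, 0 < delta & (P [set w | (b w 0%N < delta)%R] < 1)%E.
  apply: exists_small_lt1 => //.
  apply: le_lt_trans A0_nontrivial; rewrite le_eqVlt; apply/orP; left; apply/eqP.
  congr (P _); apply/seteqP; split=> w /=; rewrite /b.
    by move/eqP; rewrite sqrf_eq0 => /eqP; exact: Normc.eq0_normc.
  by move=> ->; rewrite Normc.normc0 expr0n.
have bL1 : (\int[P]_w (b w 0%N)%:E < +oo)%E by move: A0_L2; rewrite unlock.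
pose G w := dominating r delta (b w).
have G0 w : (0 <= G w)%E.
  by apply: nneseries_ge0 => t _ _; apply: nneseries_ge0 => j _ _;
    rewrite lee_fin dominating_term_ge0.
have mG : measurable_fun setT G by exact: measurable_dominating.
have iG : P.-integrable setT G.
  apply/integrableP; split => //.
  under eq_integral do rewrite gee0_abs //.
  exact: integral_dominating.
have ratioE n w : ratio n w =
    Num.sqrt (weighted_num r (b w) n / weighted_den r (b w) n) / r.
  exact: deriv_ratioE.
have mratio n : measurable_fun setT (ratio n).
  rewrite (_ : ratio n = fun w => Num.sqrt
    (weighted_num r (b w) n / weighted_den r (b w) n) / r); last first.
    by apply/funext => w.
  apply: measurable_funM; last exact: measurable_cst.
  apply: measurable_sqrt_ratio => [||w|w]; last 2 first.
  - exact: num_ge0.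
  - exact: den_ge0.
  - apply: measurable_sum => k; apply: measurable_funM; first exact: measurable_cst.
    by apply: measurable_funM; [exact: mb|exact: measurable_cst].
  - by apply: measurable_sum => k; apply: measurable_funM; [exact: mb|exact: measurable_cst].
(* The value 1 on the null event where [G] is infinite makes [X] positive everywhere. *)
pose X w := if (G w < +oo)%E then limn (ratio ^~ w) else 1.
have ratio_lim w : (G w < +oo)%E -> exists2 l : R, 0 < l & ratio n w @[n --> \oo] --> l.
  move=> Goo; have [l l0 cvl] := ratio_cvg r_gt0 delta0 (b0 w) Goo.
  exists (Num.sqrt l / r); first by rewrite divr_gt0 // sqrtr_gt0.
  rewrite (_ : ratio ^~ w = fun n => Num.sqrt
    (weighted_num r (b w) n / weighted_den r (b w) n) / r); last first.
    by apply/funext => n.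
  apply: cvgM; last exact: cvg_cst.
  by apply: (cvg_comp _ _ cvl); exact: sqrt_continuous.
have X_gt0 w : 0 < X w.
  rewrite /X; case: ifPn => // /ratio_lim[l l0 cvl].
  by rewrite (cvg_lim _ cvl).
have X_cvg w : (G w < +oo)%E -> ratio n w @[n --> \oo] --> X w.
  by move=> Gw; have [l l0 cvl] := ratio_lim w Gw; rewrite /X Gw (cvg_lim _ cvl).
have mX : measurable_fun setT X.
  (* The ratios are modified on the same event, so that they converge to [X] at every point. *)
  apply: (@measurable_fun_cvg _ _ _ _ (fun n w => if (G w < +oo)%E then ratio n w else 1)).
    move=> n; apply: measurable_fun_ifT => //.
    by apply: measurable_fun_lte.
  move=> w _; case Gw : (G w < +oo)%E; first by move: (X_cvg w Gw).
  by rewrite /X Gw; exact: cvg_cst.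
have ae_G : {ae P, forall w, (G w < +oo)%E}.
  apply: filterS (integrable_ae measurableT iG) => w /(_ I).
  by rewrite ge0_fin_numE.
have ae_cvg : {ae P, forall w, ratio n w @[n --> \oo] --> X w}.
  by apply: filterS ae_G => w; exact: X_cvg.
(* [G] bounds the squared quantity; [sqrt y <= 1 + y] for [y >= 0] removes the root and preserves
   integrability. *)
pose H w := (r^-1%:E * (1 + G w))%E.
have iH : P.-integrable setT H.
  apply: integrableZl => //; apply: integrableD => //.
  exact: finite_measure_integrable_cst.
have ratio_le n w : (`|(ratio n w)%:E| <= H w)%E.
  have r0 : 0 <= r^-1 by rewrite invr_ge0 ltW.
  rewrite ratioE gee0_abs ?lee_fin ?mulr_ge0 ?sqrtr_ge0 // mulrC EFinM.
  apply: lee_wpmul2l; first by rewrite lee_fin.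
  apply: le_trans (leeD2l 1%E (ratio_le_dominating r_gt0 delta0 (b0 w) n)).
  rewrite -EFinD lee_fin; set y := _ / _.
  have y0 : 0 <= y by rewrite divr_ge0 ?num_ge0 ?den_ge0.
  have := sqr_sqrtr y0; have := sqrtr_ge0 y; set s := Num.sqrt y; nra.
have [iX _ cvgE] : [/\ P.-integrable setT (EFin \o X),
    (\int[P]_w `|(ratio n w)%:E - (X w)%:E|)%E @[n --> \oo] --> 0%E &
    (\int[P]_w (ratio n w)%:E)%E @[n --> \oo] --> (\int[P]_w (X w)%:E)%E].
  apply: (@dominated_convergence _ _ _ P setT measurableT
    (fun n w => (ratio n w)%:E) (EFin \o X) H) => //.
  - by move=> n; exact/measurable_EFinP.
  - exact/measurable_EFinP.
  - by apply: filterS ae_cvg => w Xw _; apply: cvg_EFin; [exact: nearW|exact: Xw].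
  - by apply: aeW => w n _.
pose mXfun := isMeasurableFun.Build _ _ _ _ X mX.
pose X' : {mfun T >-> R} := HB.pack X mXfun.
exists X'; split => //=.
- by rewrite unlock; exact: cvgE.
- move/integrableP: iX => [_]; rewrite unlock.
  by under eq_integral => w _ do rewrite /= ger0_norm ?(ltW (X_gt0 w)) //.
Qed.
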